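(* Let $\Gamma$ be the Lie group given by the presentation $$\Gamma = \left\langle a,b,z \ \middle|\ z\in S^1,\ a^3=b^3=[a,z]=[b,z]=1,\ [a,b]=\omega\right\rangle .$$ Then $\Gamma$ acts freely and smoothly on $S^5\times S^5$.
   Context: Here $S^1\subseteq\mathbb{C}$ is the unit circle group, $\omega=e^{2\pi i/3}\in S^1$, and $[x,y]=x^{-1}y^{-1}xy$. The presentation means that $\Gamma$ is generated by $a$, $b$ and the circle group $S^1$ (whose own group relations hold), with $S^1$ central, $a^3=b^3=1$ and $[a,b]=\omega\in S^1$. Thus $\Gamma$ is a non-abelian central extension of $\mathbb{Z}/3\times\mathbb{Z}/3$ by $S^1$, a compact one-dimensional Lie group. *)

(* Defs.v *)
From HB Require Import structures.
From mathcomp Require Import all_boot all_order all_algebra.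
From mathcomp Require Import all_classical all_reals all_analysis.
From mathcomp Require Import generic_quotient complex.

Set Implicit Arguments.
Unset Strict Implicit.
Unset Printing Implicit Defensive.

Import Order.TTheory GRing.Theory Num.Theory.
Import numFieldNormedType.Exports.

Local Open Scope quotient_scope.
Local Open Scope classical_set_scope.
Local Open Scope ring_scope.

Inductive gexpr (X : Type) : Type :=
| GGen of X
| GOne
| GMul of gexpr X & gexpr X
| GInv of gexpr X.
Arguments GOne {X}.

(* Raw operations on expressions, satisfying no law; they give access to the
   notations [*], [1], [^-1], [^+] and [[~ x, y] = x^-1 * (y^-1 * (x * y))]. *)
HB.instance Definition _ (X : Type) := hasMul.Build (gexpr X) (@GMul X).
HB.instance Definition _ (X : Type) := hasOne.Build (gexpr X) (@GOne X).
HB.instance Definition _ (X : Type) := hasInv.Build (gexpr X) (@GInv X).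
HB.instance Definition _ (X : Type) := gen_eqMixin (gexpr X).
HB.instance Definition _ (X : Type) := gen_choiceMixin (gexpr X).

(* The least congruence that contains [rel] and the group axioms. *)
Inductive pres_eq (X : Type) (rel : gexpr X -> gexpr X -> Prop) :
    gexpr X -> gexpr X -> Prop :=
| pres_rel u v : rel u v -> pres_eq rel u v
| pres_refl u : pres_eq rel u u
| pres_sym u v : pres_eq rel u v -> pres_eq rel v u
| pres_trans u v w : pres_eq rel u v -> pres_eq rel v w -> pres_eq rel u w
| pres_mul u u' v v' : pres_eq rel u u' -> pres_eq rel v v' ->
    pres_eq rel (u * v)%g (u' * v')%g
| pres_inv u u' : pres_eq rel u u' -> pres_eq rel (u^-1)%g (u'^-1)%g
| pres_mulA u v w : pres_eq rel (u * (v * w))%g (u * v * w)%g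
| pres_mul1 u : pres_eq rel (1 * u)%g u
| pres_1mul u : pres_eq rel (u * 1)%g u
| pres_mulV u : pres_eq rel (u^-1 * u)%g 1%g
| pres_Vmul u : pres_eq rel (u * u^-1)%g 1%g.

Section PresentedGroup.
Variables (X : Type) (rel : gexpr X -> gexpr X -> Prop).

Definition pres_eqb (u v : gexpr X) : bool := `[< pres_eq rel u v >].

Lemma pres_eqb_refl : reflexive pres_eqb.
Proof. by move=> u; apply/asboolP/pres_refl. Qed.

Lemma pres_eqb_sym : symmetric pres_eqb.
Proof. by move=> u v; apply/asboolP/asboolP; exact: pres_sym. Qed.

Lemma pres_eqb_trans : transitive pres_eqb.
Proof.
by move=> v u w /asboolP uv /asboolP vw; apply/asboolP; exact: pres_trans vw.
Qed.

Canonical pres_equiv :=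
  EquivRel pres_eqb pres_eqb_refl pres_eqb_sym pres_eqb_trans.

Definition presented : Type := {eq_quot pres_equiv}.
HB.instance Definition _ := Choice.on presented.

Definition pres_class (u : gexpr X) : presented := \pi_{eq_quot pres_equiv} u.

Lemma pres_classP u v : pres_class u = pres_class v <-> pres_eq rel u v.
Proof.
split; first by move/eqmodP/asboolP.
by move=> uv; apply/eqmodP/asboolP.
Qed.

Definition pres_repr (x : presented) : gexpr X := repr (x : {eq_quot pres_equiv}).

Lemma pres_reprK x : pres_class (pres_repr x) = x.
Proof. exact: reprK. Qed.

Lemma pres_classK u : pres_eq rel (pres_repr (pres_class u)) u.
Proof. by apply/pres_classP; rewrite pres_reprK. Qed.

Definition presented_one : presented := pres_class 1%g.
Definition presented_mul (x y : presented) : presented :=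
  pres_class (pres_repr x * pres_repr y)%g.
Definition presented_inv (x : presented) : presented :=
  pres_class ((pres_repr x)^-1)%g.

Lemma pres_classM u v :
  presented_mul (pres_class u) (pres_class v) = pres_class (u * v)%g.
Proof. by apply/pres_classP/pres_mul; exact: pres_classK. Qed.

Lemma pres_classV u : presented_inv (pres_class u) = pres_class (u^-1)%g.
Proof. by apply/pres_classP/pres_inv; exact: pres_classK. Qed.

Lemma presented_mulA : associative presented_mul.
Proof.
move=> x y z; rewrite -(pres_reprK x) -(pres_reprK y) -(pres_reprK z).
by rewrite !pres_classM; apply/pres_classP/pres_mulA.
Qed.

Lemma presented_mul1g : left_id presented_one presented_mul.
Proof.
by move=> x; rewrite -(pres_reprK x) pres_classM; apply/pres_classP/pres_mul1.
Qed.

Lemma presented_mulg1 : right_id presented_one presented_mul.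
Proof.
by move=> x; rewrite -(pres_reprK x) pres_classM; apply/pres_classP/pres_1mul.
Qed.

Lemma presented_mulVg : left_inverse presented_one presented_inv presented_mul.
Proof.
move=> x; rewrite -(pres_reprK x) pres_classV pres_classM.
exact/pres_classP/pres_mulV.
Qed.

Lemma presented_mulgV : right_inverse presented_one presented_inv presented_mul.
Proof.
move=> x; rewrite -(pres_reprK x) pres_classV pres_classM.
exact/pres_classP/pres_Vmul.
Qed.

HB.instance Definition _ := isGroup.Build presented presented_mulA
  presented_mul1g presented_mulg1 presented_mulVg presented_mulgV.

End PresentedGroup.

Section Circle.
Variable R : realType.

Record circle : Type :=
  Circle { circle_val :> R[i]; circle_norm : `|circle_val| == 1 }.

HB.instance Definition _ := [isSub for circle_val].
HB.instance Definition _ := [Choice of circle by <:].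

Lemma circle_one_norm : `|1 : R[i]| == 1.
Proof. by rewrite normr1. Qed.

Lemma circle_mul_norm (z w : circle) : `|(z : R[i]) * w| == 1.
Proof.
by rewrite normrM (eqP (circle_norm z)) (eqP (circle_norm w)) mulr1.
Qed.

Lemma circle_inv_norm (z : circle) : `|(z : R[i])^-1| == 1.
Proof. by rewrite normfV (eqP (circle_norm z)) invr1. Qed.

Definition circle_one : circle := Circle circle_one_norm.
Definition circle_mul (z w : circle) : circle := Circle (circle_mul_norm z w).
Definition circle_inv (z : circle) : circle := Circle (circle_inv_norm z).

Lemma circle_neq0 (z : circle) : (z : R[i]) != 0.
Proof. by rewrite -normr_eq0 (eqP (circle_norm z)) oner_eq0. Qed.

Lemma circle_mulA : associative circle_mul.
Proof. by move=> x y z; apply/val_inj/mulrA. Qed.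

Lemma circle_mul1 : left_id circle_one circle_mul.
Proof. by move=> x; apply/val_inj/mul1r. Qed.

Lemma circle_1mul : right_id circle_one circle_mul.
Proof. by move=> x; apply/val_inj/mulr1. Qed.

Lemma circle_mulV : left_inverse circle_one circle_inv circle_mul.
Proof. by move=> x; apply/val_inj/mulVf/circle_neq0. Qed.

Lemma circle_Vmul : right_inverse circle_one circle_inv circle_mul.
Proof. by move=> x; apply/val_inj/mulfV/circle_neq0. Qed.

HB.instance Definition _ := isGroup.Build circle
  circle_mulA circle_mul1 circle_1mul circle_mulV circle_Vmul.

Lemma omega_norm :
  `|Complex (cos (2 * trigo.pi / 3)) (sin (2 * trigo.pi / 3)) : R[i]| == 1.
Proof. by rewrite normc_def /= cos2Dsin2 sqrtr1. Qed.

(* exp(2 pi i / 3) *)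
Definition omega : circle := Circle omega_norm.

End Circle.

Section Gamma.
Variable R : realType.

Inductive Gamma_gen : Type := gen_a | gen_b | gen_z of circle R.

Local Notation a := (GGen gen_a).
Local Notation b := (GGen gen_b).
Local Notation "<< z >>" := (GGen (gen_z z)).

(* [Gamma_rel_circle] is the multiplication table of the circle group. *)
Inductive Gamma_rel : gexpr Gamma_gen -> gexpr Gamma_gen -> Prop :=
| Gamma_rel_circle (z w : circle R) :
    Gamma_rel (<<z>> * <<w>>)%g <<(z * w)%g>>
| Gamma_rel_a3 : Gamma_rel (a ^+ 3)%g 1%g
| Gamma_rel_b3 : Gamma_rel (b ^+ 3)%g 1%g
| Gamma_rel_az (z : circle R) : Gamma_rel [~ a, <<z>>]%g 1%g
| Gamma_rel_bz (z : circle R) : Gamma_rel [~ b, <<z>>]%g 1%g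
| Gamma_rel_ab : Gamma_rel [~ a, b]%g <<omega R>>.

Definition Gamma : groupType := presented Gamma_rel.

Definition Gamma_circle (z : circle R) : Gamma := pres_class Gamma_rel <<z>>.

(* The Lie group structure of [Gamma] is the one for which the circle subgroup
   is open with its usual smooth structure.  The left cosets of the circle are
   then open and cover [Gamma], and these maps are diffeomorphisms from the
   circle onto them. *)
Definition Gamma_coset (g : Gamma) (z : circle R) : Gamma :=
  (g * Gamma_circle z)%g.

End Gamma.

Section Smooth.
Variable R : realType.

(* [f] is of class C^k on the open set [U]: its iterated directional
   derivatives of order at most [k] exist and are continuous on [U].  This is
   the usual notion when [V] is finite dimensional. *)
Fixpoint Ck (V W : normedModType R) (k : nat) (U : set V) (f : V -> W) : Prop :=
  (forall x, U x -> {for x, continuous f}) /\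
  match k with
  | 0%N => True
  | k'.+1 => forall v : V,
      (forall x, U x -> derivable f x v) /\ Ck k' U ('D_v f)
  end.

Definition Cinfty (V W : normedModType R) (U : set V) (f : V -> W) : Prop :=
  forall k : nat, Ck k U f.

(* Smoothness of a map between submanifolds of vector spaces, given by their
   inclusions [iX] and [iY]: locally, [f] is the restriction of a smooth map
   defined on an open subset of the ambient space. *)
Definition smooth_map (X Y : Type) (V W : normedModType R)
    (iX : X -> V) (iY : Y -> W) (f : X -> Y) : Prop :=
  forall x : X, exists (U : set V) (F : V -> W),
    [/\ open U, U (iX x), Cinfty U F &
        forall x' : X, U (iX x') -> F (iX x') = iY (f x')].

(* The Euclidean unit sphere; the library norm on ['rV[R]_n.+1] is the
   max norm. *)
Definition sphere (n : nat) : Type :=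
  {x : 'rV[R]_n.+1 | \sum_(i < n.+1) x ord0 i ^+ 2 == 1}.

Definition sphere_incl (n : nat) (x : sphere n) : 'rV[R]_n.+1 := val x.

Definition circle_incl (z : circle R) : (R * R)%type :=
  (complex.Re (z : R[i]), complex.Im (z : R[i])).

Definition prod_incl (X Y V W : Type) (iX : X -> V) (iY : Y -> W)
  (p : X * Y) : V * W := (iX p.1, iY p.2).

Definition S5xS5 : Type := (sphere 5 * sphere 5)%type.

Definition S5xS5_incl : S5xS5 -> 'rV[R]_6 * 'rV[R]_6 :=
  prod_incl (@sphere_incl 5) (@sphere_incl 5).

End Smooth.

Definition is_left_action (G : groupType) (M : Type) (act : G -> M -> M) : Prop :=
  (forall x, act 1%g x = x) /\
  (forall g h x, act (g * h)%g x = act g (act h x)).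

Definition is_free_action (G : groupType) (M : Type) (act : G -> M -> M) : Prop :=
  forall g x, act g x = x -> g = 1%g.

(* Smoothness of the map [(g, x) |-> act g x] on [Gamma * (S^5 * S^5)], read on each of
   the open sets [(g S^1) * (S^5 * S^5)]. *)
Definition is_smooth_action (R : realType)
    (act : Gamma R -> S5xS5 R -> S5xS5 R) : Prop :=
  forall g : Gamma R,
    smooth_map (prod_incl (@circle_incl R) (@S5xS5_incl R)) (@S5xS5_incl R)
      (fun p : circle R * S5xS5 R => act (Gamma_coset g p.1) p.2).

(* Main.v *)
Require Import Defs.
From HB Require Import structures.
From mathcomp Require Import all_boot all_order all_algebra.
From mathcomp Require Import all_classical all_reals all_analysis.
From mathcomp Require Import complex ring lra.

Set Implicit Arguments.
Unset Strict Implicit.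
Unset Printing Implicit Defensive.

Import Order.TTheory GRing.Theory Num.Theory.
Import numFieldNormedType.Exports.

Local Open Scope classical_set_scope.
Local Open Scope ring_scope.

(** Every element of [Gamma] is [z * a ^+ i * b ^+ j], and [Gamma] acts on
    [C^3] by the Schroedinger representation: [a] multiplies the coordinate [k]
    by [omega ^+ k], [b] shifts coordinates and [S^1] acts by scalars.  On the
    unit sphere a nontrivial isotropy group has order 3 and projects onto one of
    the four lines of [(Z/3)^2].  Let [h] run over [a], [b], [ab], [a^2 b], which
    represent these four lines.  The function [<v, h v>] is multiplied by a
    character of [Gamma] under the action, the character being trivial exactly
    on the line of [h], and the four functions form a map [F] from [S^5] to
    [S^7]: [sum_h |<v, h v>|^2 = 1] by Parseval, as the nine operators
    [a^m b^n / sqrt 3] are an orthonormal basis of [M_3(C)].  If [g], not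
    central, fixes [v], then [F v] lies on the one coordinate axis where [g] acts
    trivially, so [g] has no fixed vector in the orthogonal complement of [F v]
    in [C^4]: [Gamma] acts freely on the unit sphere bundle of this complement.
    The coordinate [<v, a v>] is never [-1], so the complement of [F v] is
    identified with the complement [C^3] of the first axis by the unitary
    reflection that takes [- e_1] to [F v].  In this trivialization the
    action on the second sphere has the closed form [fibre_map]. *)

(** * Relations and commutators in a presented group *)

Section PresentedMorphism.
Variables (X : Type) (rel : gexpr X -> gexpr X -> Prop).

Lemma pres_class_rel u v : rel u v -> pres_class rel u = pres_class rel v.
Proof. by move=> uv; apply/pres_classP/pres_rel. Qed.

Lemma pres_class_mulg u v :
  pres_class rel (u * v)%g = (pres_class rel u * pres_class rel v)%g.
Proof. by rewrite -pres_classM. Qed.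

Lemma pres_class_invg u : pres_class rel (u^-1)%g = ((pres_class rel u)^-1)%g.
Proof. by rewrite -pres_classV. Qed.

Lemma pres_class_commg u v :
  pres_class rel [~ u, v]%g = [~ pres_class rel u, pres_class rel v]%g.
Proof. by rewrite !pres_class_mulg !pres_class_invg. Qed.

End PresentedMorphism.

(** * Powers of two elements whose commutator is central *)

Section CommutatorPowers.
Variables (G : groupType) (x y c : G).
Hypotheses (xc : commute x c) (yc : commute y c) (xy : (x * y = y * x * c)%g).

Lemma central_commgXl m : (x ^+ m * y = y * x ^+ m * c ^+ m)%g.
Proof.
elim: m => [|m IH]; first by rewrite !expg0 !mulg1 mul1g.
rewrite {1}expgS -mulgA IH !mulgA xy -[(_ * c * _)%g]mulgA.
by rewrite (commuteX m (commute_sym xc)) !expgS !mulgA.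
Qed.

Lemma central_commgX m n : (x ^+ m * y ^+ n = y ^+ n * x ^+ m * c ^+ (m * n))%g.
Proof.
elim: n => [|n IH]; first by rewrite muln0 !expg0 !mulg1 mul1g.
rewrite {1}expgS mulgA central_commgXl -[(_ * c ^+ m * _)%g]mulgA.
rewrite (commute_sym (commuteX2 n m yc)) mulgA -[(y * _ * _)%g]mulgA IH.
by rewrite !mulgA -expgS -!mulgA -expgnDr mulnS addnC.
Qed.

End CommutatorPowers.

(** * The universal property of a presentation *)

Section PresentedHom.
Variables (X : Type) (rel : gexpr X -> gexpr X -> Prop) (G : groupType).
Variable f : X -> G.

Fixpoint gexpr_eval (u : gexpr X) : G :=
  match u with
  | GGen x => f x
  | GOne => 1%g
  | GMul u v => (gexpr_eval u * gexpr_eval v)%g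
  | GInv u => ((gexpr_eval u)^-1)%g
  end.

Hypothesis f_rel : forall u v, rel u v -> gexpr_eval u = gexpr_eval v.

Lemma gexpr_eval_pres_eq u v : pres_eq rel u v -> gexpr_eval u = gexpr_eval v.
Proof.
elim=> {u v} /= => [u v /f_rel //|u //|u v _ -> //|u v w _ -> _ //|
  u u' v v' _ -> _ -> //|u u' _ -> //|u v w|u|u|u|u].
- exact: mulgA.
- exact: mul1g.
- exact: mulg1.
- exact: mulVg.
- exact: mulgV.
Qed.

Definition presented_hom (x : presented rel) : G := gexpr_eval (pres_repr x).

Lemma presented_hom_class u : presented_hom (pres_class rel u) = gexpr_eval u.
Proof. exact/gexpr_eval_pres_eq/pres_classK. Qed.

Lemma presented_homM x y :
  presented_hom (x * y)%g = (presented_hom x * presented_hom y)%g.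
Proof. exact: presented_hom_class. Qed.

Lemma presented_hom1 : presented_hom 1%g = 1%g.
Proof. exact: presented_hom_class. Qed.

End PresentedHom.

Lemma presented_ind (X : Type) (rel : gexpr X -> gexpr X -> Prop)
    (P : presented rel -> Prop) :
  (forall x, P (pres_class rel (GGen x))) -> P 1%g ->
  (forall x y, P x -> P y -> P (x * y)%g) -> (forall x, P x -> P (x^-1)%g) ->
  forall x, P x.
Proof.
move=> Pg P1 PM PV x; rewrite -(pres_reprK x).
elim: (pres_repr x) => [y||u Pu v Pv|u Pu] //.
- by rewrite -[GMul u v]/(u * v)%g -pres_classM; exact: PM.
- by rewrite -[GInv u]/(u^-1)%g -pres_classV; exact: PV.
Qed.

(** * Exponents modulo 3 *)

Section CubeRootPowers.
Variables (G : groupType) (x : G).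
Hypothesis x3 : (x ^+ 3 = 1)%g.

Lemma expg_mod3 n : (x ^+ (n %% 3) = x ^+ n)%g.
Proof. by rewrite [in RHS](divn_eq n 3) expgnDr mulnC expgnA x3 expg1n mul1g. Qed.

Lemma expg_ord3D (i j : 'I_3) : (x ^+ (i + j)%R = x ^+ i * x ^+ j)%g.
Proof. by rewrite [LHS]expg_mod3 expgnDr. Qed.

Lemma expg_ord3N (i : 'I_3) : (x ^+ (- i)%R = (x ^+ i)^-1)%g.
Proof. by apply: (mulIg (x ^+ i)%g); rewrite mulVg -expg_ord3D addNr. Qed.

Lemma expg_ord3M (i j : 'I_3) : (x ^+ (i * j)%R = x ^+ (i * j)%N)%g.
Proof. exact: expg_mod3. Qed.

End CubeRootPowers.

(** * The primitive cube root of unity *)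

Section Omega.
Variable R : realType.
Local Notation C := R[i].
Local Notation w := (omega R : C).

Lemma circle_valM (x y : circle R) : (x * y)%g = (x : C) * y :> C.
Proof. by []. Qed.

Lemma circle_mul_conj (x : circle R) : (x : C) * (x : C)^* = 1.
Proof. by rewrite -normCK (eqP (circle_norm x)) expr1n. Qed.

Lemma circle_valV (x : circle R) : (x^-1)%g = (x : C)^* :> C.
Proof.
apply: (mulfI (circle_neq0 x)); rewrite circle_mul_conj.
exact/mulfV/circle_neq0.
Qed.

(** The triple angle formula turns [cos (3 t) = 1] into [(c - 1) * (2 * c + 1) ^+ 2 = 0] for
    [c = cos t]. The root 1 is excluded because [cos] is injective on [[0, pi]] and [t] is not 0. *)
Lemma cos_2pi3 : cos (2 * pi / 3) = - 2^-1 :> R.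
Proof.
set t := 2 * pi / 3.
have : cos (t + (t + t)) = 1.
  by rewrite (_ : t + (t + t) = pi *+ 2) ?cos2pi// /t; field.
rewrite !cosD sinD; have := cos2Dsin2 t.
set c := cos t; set s := sin t => cs e.
have {e} : (c - 1) * (2 * c + 1) ^+ 2 = 0.
  rewrite [LHS](_ : _ = (c * (c * c - s * s) - s * (s * c + c * s) - 1)
    + 3 * c * (c ^+ 2 + s ^+ 2 - 1)); last by ring.
  by rewrite e cs !subrr mulr0 addr0.
move=> /eqP; rewrite mulf_eq0 expf_eq0/= => /orP[|/eqP h]; last by lra.
rewrite subr_eq0 => /eqP c1.
have p0 := pi_gt0 R.
have : t = 0.
  by apply: cos_inj; rewrite ?cos0// in_itv/= ?lexx/= /t; first apply/andP; lra.
by rewrite /t; lra.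
Qed.

Lemma omega_sum : 1 + w + w ^+ 2 = 0.
Proof.
have c := cos_2pi3; have s := cos2Dsin2 (2 * pi / 3 : R).
rewrite /= c in s *; move: (sin _) s => s hs.
have s2 : s ^+ 2 = 3 / 4 by lra.
rewrite expr2; apply/eqP; rewrite eq_complex/= !addrA; apply/andP; split.
  by apply/eqP; rewrite -[s * s]expr2 s2; lra.
by apply/eqP; lra.
Qed.

Lemma omega_sqr : w ^+ 2 = - 1 - w.
Proof. by have /eqP := omega_sum; rewrite addrC addr_eq0 => /eqP ->; ring. Qed.

Lemma omega3 : (omega R ^+ 3 = 1)%g.
Proof.
apply: val_inj; rewrite -[val _]/(w * (w * w)) -expr2 omega_sqr.
by rewrite mulrBr mulrN1 -expr2 omega_sqr /=; ring.
Qed.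

(** Exponents are taken in the ring ['I_3] of integers modulo 3, so that [omegaX] is a character and
    identities between exponents can be left to [ring]. *)
Definition omegaX (k : 'I_3) : circle R := (omega R ^+ k)%g.

Lemma omegaX0 : omegaX 0 = 1%g. Proof. by []. Qed.

Lemma omegaXD i j : omegaX (i + j) = (omegaX i * omegaX j)%g.
Proof. exact: expg_ord3D omega3 i j. Qed.

Lemma omegaXN i : omegaX (- i) = ((omegaX i)^-1)%g.
Proof. exact: expg_ord3N omega3 i. Qed.

(** Otherwise [omega_sum] would read 3 = 0. *)
Lemma omega_neq1 : omega R <> 1%g.
Proof.
move=> w1; have : 3%:R = 0 :> C.
  by rewrite -[RHS]omega_sum w1 -[circle_val _]/(1 : C); ring.
by move/eqP; rewrite pnatr_eq0.
Qed.

Lemma omegaX_eq1 k : omegaX k = 1%g -> k = 0.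
Proof.
case: k => -[|[|[|//]]] lt3 h; apply: val_inj => //=; case: omega_neq1.
  by rewrite -h.
by rewrite -[LHS]mulg1 -h -expgS omega3.
Qed.

Lemma omegaX_sum : \sum_k (omegaX k : C) = 0.
Proof. by rewrite !big_ord_recl big_ord0 -[RHS]omega_sum /= expr2 addr0 addrA. Qed.

End Omega.

Arguments omegaX : simpl never.

(** * A normal form for the elements of [Gamma] *)

Section HeisenbergGroup.
Variable R : realType.

(* [Heis z i j] stands for [z * a ^+ i * b ^+ j]. *)
Record heis := Heis { heis_z : circle R; heis_i : 'I_3; heis_j : 'I_3 }.

HB.instance Definition _ := gen_eqMixin heis.
HB.instance Definition _ := gen_choiceMixin heis.

Implicit Types g h : heis.

Lemma heis_eq (z z' : circle R) i i' j j' : z = z' :> R[i] -> i = i' -> j = j' ->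
  Heis z i j = Heis z' i' j'.
Proof. by move=> /val_inj -> -> ->. Qed.

(* The last factor of the circle component comes from
   [b ^+ j * a ^+ k = omega ^- (j * k) * (a ^+ k * b ^+ j)]. *)
Definition heis_mul g h := Heis
  (heis_z g * heis_z h * omegaX R (- (heis_j g * heis_i h)))%g
  (heis_i g + heis_i h) (heis_j g + heis_j h).
Definition heis_one := Heis 1%g 0 0.
(** Reordering [b ^- j * a ^- i] produces the factor [omega ^- (i * j)]. *)
Definition heis_inv g := Heis
  ((heis_z g)^-1 * omegaX R (- (heis_i g * heis_j g)))%g
  (- heis_i g) (- heis_j g).

Lemma heis_mulA : associative heis_mul.
Proof.
case=> [z i j] [y k l] [x m n]; apply: heis_eq; rewrite ?addrA//=.
rewrite mulrDr mulrDl !opprD !omegaXD !circle_valM /=; ring.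
Qed.

Lemma heis_mul1 : left_id heis_one heis_mul.
Proof.
case=> z i j; rewrite /heis_mul /= !add0r mul0r oppr0 omegaX0.
by rewrite mul1g mulg1.
Qed.

Lemma heis_1mul : right_id heis_one heis_mul.
Proof.
by case=> z i j; rewrite /heis_mul /= !addr0 mulr0 oppr0 omegaX0 !mulg1.
Qed.

Lemma heis_mulV : left_inverse heis_one heis_inv heis_mul.
Proof.
case=> z i j; rewrite /heis_mul /= !addNr mulNr opprK omegaXN mulrC.
apply: heis_eq => //; rewrite /=.
by field; rewrite !circle_neq0.
Qed.

Lemma heis_Vmul : right_inverse heis_one heis_inv heis_mul.
Proof.
case=> z i j; rewrite /heis_mul /= !addrN mulrN opprK omegaXN mulrC.
apply: heis_eq => //; rewrite /=.
by field; rewrite !circle_neq0.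
Qed.

HB.instance Definition _ := isGroup.Build heis
  heis_mulA heis_mul1 heis_1mul heis_mulV heis_Vmul.

Definition heis_gen (x : Gamma_gen R) : heis :=
  match x with
  | gen_a => Heis 1%g 1 0
  | gen_b => Heis 1%g 0 1
  | gen_z z => Heis z 0 0
  end.

Lemma heis_gen_rel u v : Gamma_rel u v ->
  gexpr_eval heis_gen u = gexpr_eval heis_gen v.
Proof.
case=> [z y|||z|z|]; apply: heis_eq => //=.
all: try by rewrite !(invr1, mul1r, mulr1) ?mulVf ?circle_neq0.
all: exact/val_inj.
Qed.

Local Notation rel := (@Gamma_rel R).
Local Notation A := (pres_class rel (GGen (gen_a R))).
Local Notation B := (pres_class rel (GGen (gen_b R))).
Local Notation Z := (@Gamma_circle R).

Definition heis_of : Gamma R -> heis := @presented_hom _ rel heis heis_gen.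

Lemma heis_ofM x y : heis_of (x * y)%g = (heis_of x * heis_of y)%g.
Proof. exact: presented_homM heis_gen_rel x y. Qed.

Lemma heis_of1 : heis_of 1%g = 1%g.
Proof. exact: presented_hom1 heis_gen_rel. Qed.

Lemma heis_of_gen x : heis_of (pres_class rel (GGen x)) = heis_gen x.
Proof. exact: presented_hom_class heis_gen_rel _. Qed.

Definition Gamma_of (h : heis) : Gamma R :=
  (Z (heis_z h) * A ^+ heis_i h * B ^+ heis_j h)%g.

Lemma Gamma_circleM x y : Z (x * y)%g = (Z x * Z y)%g.
Proof. by rewrite -pres_class_mulg; apply/esym/pres_class_rel; constructor. Qed.

Lemma Gamma_circle1 : Z 1%g = 1%g.
Proof. by apply: (mulgI (Z 1%g)); rewrite -Gamma_circleM !mulg1. Qed.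

Lemma Gamma_circleX x n : Z (x ^+ n)%g = (Z x ^+ n)%g.
Proof.
by elim: n => [|n IH]; rewrite ?expg0 ?Gamma_circle1// !expgS Gamma_circleM IH.
Qed.

Lemma Gamma_circleV x : Z (x^-1)%g = ((Z x)^-1)%g.
Proof. by apply: (mulgI (Z x)); rewrite -Gamma_circleM !mulgV Gamma_circle1. Qed.

Lemma Gamma_a3 : (A ^+ 3 = 1)%g.
Proof.
by have := pres_class_rel (Gamma_rel_a3 R); rewrite !pres_class_mulg.
Qed.

Lemma Gamma_b3 : (B ^+ 3 = 1)%g.
Proof.
by have := pres_class_rel (Gamma_rel_b3 R); rewrite !pres_class_mulg.
Qed.

Lemma Gamma_az z : commute A (Z z).
Proof.
by apply/commgP/eqP; rewrite -pres_class_commg; apply/pres_class_rel/Gamma_rel_az.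
Qed.

Lemma Gamma_bz z : commute B (Z z).
Proof.
by apply/commgP/eqP; rewrite -pres_class_commg; apply/pres_class_rel/Gamma_rel_bz.
Qed.

Lemma Gamma_ab : (A * B = B * A * Z (omega R))%g.
Proof.
rewrite commgC -pres_class_commg; congr (_ * _)%g.
exact/pres_class_rel/Gamma_rel_ab.
Qed.

Lemma Gamma_ba (j k : 'I_3) :
  (B ^+ j * A ^+ k = Z (omegaX R (- (j * k))) * A ^+ k * B ^+ j)%g.
Proof.
rewrite omegaXN /omegaX (expg_ord3M (omega3 R)) Gamma_circleV Gamma_circleX.
rewrite -mulgA (central_commgX (Gamma_az _) (Gamma_bz _) Gamma_ab) mulnC.
rewrite (_ : commute (B ^+ j * A ^+ k)%g _) ?mulKg//.
apply/commuteX/commute_sym/commuteM; apply/commuteX/commute_sym.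
  exact: Gamma_bz.
exact: Gamma_az.
Qed.

Lemma Gamma_ofM g h : Gamma_of (g * h)%g = (Gamma_of g * Gamma_of h)%g.
Proof.
case: g h => [z i j] [y k l]; rewrite /Gamma_of /=.
rewrite (expg_ord3D Gamma_a3) (expg_ord3D Gamma_b3) !Gamma_circleM.
set t := omegaX _ _; have Zc x n : commute (A ^+ n)%g (Z x).
  by apply/commute_sym/commuteX/commute_sym/Gamma_az.
have ZcB x n : commute (B ^+ n)%g (Z x).
  by apply/commute_sym/commuteX/commute_sym/Gamma_bz.
rewrite !mulgA -[(_ * B ^+ j * Z y)%g]mulgA ZcB mulgA.
rewrite -[(_ * A ^+ i * Z y)%g]mulgA Zc mulgA.
rewrite -[(_ * B ^+ j * A ^+ k)%g]mulgA Gamma_ba !mulgA.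
by rewrite -[(_ * A ^+ i * Z _)%g]mulgA Zc !mulgA.
Qed.

(** Both maps are multiplicative and the composite fixes the generators. This makes [heis_of]
    injective, so a free action of [heis] pulls back to a free action of [Gamma]. *)
Lemma heis_ofK x : Gamma_of (heis_of x) = x.
Proof.
have Gamma_of1 : Gamma_of 1%g = 1%g.
  by apply: (mulgI (Gamma_of 1%g)); rewrite -Gamma_ofM !mulg1.
elim/presented_ind: x => [x||x y IHx IHy|x IHx].
- rewrite heis_of_gen; case: x => [||z]; rewrite /Gamma_of /=.
  + by rewrite Gamma_circle1 mul1g mulg1.
  + by rewrite Gamma_circle1 !mul1g.
  + by rewrite !mulg1.
- by rewrite heis_of1.
- by rewrite heis_ofM Gamma_ofM IHx IHy.
(* For an inverse, it suffices to compare after multiplication by [x], which the composite fixes. *)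
apply: (mulgI x); rewrite mulgV -{1}IHx -Gamma_ofM -heis_ofM mulgV.
by rewrite heis_of1.
Qed.

Lemma heis_of_inj x : heis_of x = 1%g -> x = 1%g.
Proof. by move=> x1; rewrite -[x]heis_ofK x1 -heis_of1 heis_ofK. Qed.

End HeisenbergGroup.

(** * The Schroedinger representation and the action on the fibres *)

Section WeylCoefficients.
Variable R : realType.
Local Notation C := R[i].
Local Notation W k := (omegaX R k : C).
Implicit Types (v x w : 'I_3 -> C) (g h : heis R) (d t : C).

Lemma WD i j : W (i + j) = W i * W j.
Proof. by rewrite omegaXD. Qed.

Lemma W_conj i : (W i)^* = W (- i).
Proof. by rewrite omegaXN circle_valV. Qed.

Lemma conjcD (x y : C) : (x + y)^* = x^* + y^*.
Proof. exact: rmorphD. Qed.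

Lemma conjcM (x y : C) : (x * y)^* = x^* * y^*.
Proof. exact: rmorphM. Qed.

Lemma W_mul_conj i : W i * (W i)^* = 1.
Proof. exact: circle_mul_conj. Qed.

Definition schroedinger g v : 'I_3 -> C :=
  fun k => (heis_z g : C) * W (heis_i g * k) * v (k - heis_j g).

(* [<v, a ^+ m b ^+ n v>], with the form antilinear on the left. *)
Definition weyl (m n : 'I_3) v : C := \sum_k (v k)^* * W (m * k) * v (k - n).

Definition dot x w : C := \sum_k (x k)^* * w k.

Lemma schroedinger1 v : schroedinger 1%g v = v.
Proof.
apply/funext => k; rewrite -[1%g]/(heis_one R) /schroedinger /=.
by rewrite subr0 !mul1r.
Qed.

(** Moving the shift by [heis_j g] past the diagonal factor of [h] yields exactly the root of unity
    in [heis_mul]. *)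
Lemma schroedingerM g h v :
  schroedinger (g * h)%g v = schroedinger g (schroedinger h v).
Proof.
apply/funext => k; rewrite /schroedinger /= opprD addrA mulrBr mulrDl !WD.
by rewrite [heis_j g * _]mulrC; ring.
Qed.

(** Conjugation by [g] multiplies [a ^+ m b ^+ n] by a power of [omega], since commutators are
    central. *)
Lemma weyl_schroedinger m n g v : weyl m n (schroedinger g v) =
  W (m * heis_j g - heis_i g * n) * weyl m n v.
Proof.
(* Translating the summation index undoes the shift by [g]; the remaining phases cancel against
   their conjugates. *)
rewrite /weyl (reindex_inj (addIr (heis_j g))) mulr_sumr.
apply: eq_bigr => k _; rewrite /schroedinger.
have -> : k + heis_j g - n - heis_j g = k - n by ring.
have -> : k + heis_j g - heis_j g = k by ring.
rewrite !rmorphM /= W_conj !(mulrBr, mulrDr, opprD) !WD.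
have zz := circle_mul_conj (heis_z g).
have ww := W_mul_conj (heis_i g * k).
have ww' := W_mul_conj (heis_i g * heis_j g).
move: zz ww ww'; rewrite !W_conj.
set z := (heis_z g : C); set z' := z^*; set p := W (heis_i g * k).
set q := W (- (heis_i g * k)); set r := W (heis_i g * heis_j g).
set s := W (- (heis_i g * heis_j g)) => zz pq rs.
by ring: zz pq rs.
Qed.

Definition vnorm v := dot v v.

Lemma vnormE v : vnorm v = weyl 0 0 v.
Proof. by apply: eq_bigr => k _; rewrite mul0r omegaX0 mulr1 subr0. Qed.

Lemma vnorm_schroedinger g v : vnorm (schroedinger g v) = vnorm v.
Proof. by rewrite !vnormE weyl_schroedinger mul0r mulr0 subrr omegaX0 mul1r. Qed.

Lemma dot_conj x w : (dot x w)^* = dot w x.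
Proof.
rewrite /dot rmorph_sum; apply: eq_bigr => k _.
by rewrite rmorphM /= conjCK mulrC.
Qed.

(** The components of [F] for [b], [ab] and [a^2 b]; the fourth, for [a], is [weyl 1 0]. *)
Definition weyl1 v : 'I_3 -> C := fun m => weyl m 1 v.

Lemma ord3E (P : 'I_3 -> Prop) : P 0 -> P 1 -> P (- 1) -> forall k, P k.
Proof.
move=> P0 P1 P2; case=> -[|[|[|//]]] lt3.
- by rewrite (_ : Ordinal lt3 = 0)//; exact: val_inj.
- by rewrite (_ : Ordinal lt3 = 1)//; exact: val_inj.
- by rewrite (_ : Ordinal lt3 = - 1)//; exact: val_inj.
Qed.

Lemma sum3E (f : 'I_3 -> C) : \sum_k f k = f 0 + f 1 + f (- 1).
Proof.
rewrite !big_ord_recl big_ord0 addr0 addrA; congr (f _ + f _ + f _); exact: val_inj.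
Qed.

Lemma WN1 : W (- 1) = - 1 - W 1.
Proof.
by have /eqP := omegaX_sum R; rewrite sum3E omegaX0 addrC addr_eq0 opprD => /eqP.
Qed.

(** Parseval for the projector onto [v] gives [3 * vnorm v ^+ 2] as the sum of [|<v, h v>|^2] over
    the nine operators. The identity contributes [vnorm v ^+ 2], and the other eight form pairs [h],
    [h^-1] of equal modulus, so one from each pair sums to [vnorm v ^+ 2]. The proof expands in
    coordinates and reduces modulo [1 + omega + omega^2 = 0]. *)
Lemma weyl_parseval v :
  weyl 1 0 v * (weyl 1 0 v)^* + vnorm (weyl1 v) = vnorm v ^+ 2.
Proof.
have W1sqr : W 1 ^+ 2 = - 1 - W 1 by rewrite -omega_sqr.
have sub11 : - 1 - 1 = 1 :> 'I_3 by exact: val_inj.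
rewrite /vnorm /dot /weyl1 /weyl !sum3E !(conjcD, conjcM, conjCK, W_conj).
rewrite !(mulr0, mul0r, mulr1, mul1r, mulrNN, mulN1r, oppr0, omegaX0, opprK,
  subr0, sub0r).
rewrite !subrr !sub11 WN1.
by ring: W1sqr.
Qed.

(** [weyl 1 0 v] is the convex combination of the cube roots of unity with weights [|v k|^2], so its
    real part is at least -1/2. Precisely, [1 + weyl 1 0 v] plus its conjugate is
    [1 + 3 |v 0|^2]. *)
Lemma weyl10_neqN1 v : vnorm v = 1 -> 1 + weyl 1 0 v != 0.
Proof.
move=> v1; apply/eqP => e.
have : 1 + 3 * ((v 0)^* * v 0) = (1 + weyl 1 0 v) + (1 + weyl 1 0 v)^* :> C.
  move: v1; rewrite /vnorm /dot /weyl !sum3E !(conjcD, conjcM, conjCK, W_conj).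
  rewrite !(mul1r, subr0, oppr0, omegaX0, opprK, mulr1) WN1 => v1.
  have p0 : (v 0)^* * v 0 = 1 - (v 1)^* * v 1 - (v (- 1))^* * v (- 1).
    by rewrite -v1; ring.
  by ring: p0.
rewrite e conjC0 addr0 => /eqP; apply/negP/lt0r_neq0.
by rewrite ltr_pwDl// mulr_ge0// mulrC -normCK exprn_ge0.
Qed.

(* On [C^3], the reflection taking [- e_1] to the unit vector [(t, x)] is
   [w |-> (- (1 + t) s / (1 + conj t), w - s / (1 + conj t) x)] with [s = <x, w>].
   Following it by multiplication of the first coordinate by [d] and the inverse
   of the reflection taking [- e_1] to [(d t, x)] gives [twist d x t]. *)
Definition kappa d t : C := (d - 1) / ((1 + t^*) * (1 + d * t)).

Definition twist d x t w : 'I_3 -> C := fun m => w m + kappa d t * dot x w * x m.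

(** The diagonal matrix of the characters by which [g] multiplies the three functions [weyl m 1]. *)
Definition diag_act g x : 'I_3 -> C :=
  fun m => W (m * heis_j g - heis_i g) * x m.

(** The diagonal action on [C^4], read in the trivializations at [v] and at its image. The factor of
    the first coordinate sits inside [twist]; the other three can be pulled out as [diag_act],
    because the reflections are equivariant. *)
Definition fibre_map g v w : 'I_3 -> C :=
  diag_act g (twist (W (heis_j g)) (weyl1 v) (weyl 1 0 v) w).

Lemma weyl1_schroedinger g v : weyl1 (schroedinger g v) = diag_act g (weyl1 v).
Proof. by apply/funext => m; rewrite /weyl1 weyl_schroedinger mulr1. Qed.

Lemma weyl10_schroedinger g v :
  weyl 1 0 (schroedinger g v) = W (heis_j g) * weyl 1 0 v.
Proof. by rewrite weyl_schroedinger mul1r mulr0 subr0. Qed.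

Lemma weyl10_twist_neqN1 g v : vnorm v = 1 ->
  1 + W (heis_j g) * weyl 1 0 v != 0.
Proof.
move=> v1; rewrite -weyl10_schroedinger; apply: weyl10_neqN1.
by rewrite vnorm_schroedinger.
Qed.

Lemma dot_diag_act g x w : dot (diag_act g x) (diag_act g w) = dot x w.
Proof.
apply: eq_bigr => m _; rewrite /diag_act conjcM.
rewrite mulrACA [X in X * _]mulrC W_mul_conj mul1r //.
Qed.

Lemma diag_actM g h x : diag_act (g * h)%g x = diag_act g (diag_act h x).
Proof.
apply/funext => m; rewrite /diag_act mulrA -WD; congr (W _ * _).
by rewrite /=; ring.
Qed.

Lemma diag_act_twist g d x t w :
  diag_act g (twist d x t w) = twist d (diag_act g x) t (diag_act g w).
Proof.
apply/funext => m; rewrite /twist dot_diag_act /diag_act mulrDr; congr (_ + _).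
by rewrite mulrCA.
Qed.

Lemma dot_addr x w w' t : dot x (fun m => w m + t * w' m) = dot x w + t * dot x w'.
Proof.
rewrite /dot mulr_sumr -big_split; apply: eq_bigr => m _ /=.
by rewrite mulrDr mulrCA.
Qed.

Lemma dot_twist d x t w :
  dot x (twist d x t w) = (1 + kappa d t * vnorm x) * dot x w.
Proof. by rewrite dot_addr -/(vnorm x); ring. Qed.

Lemma conjc_1D_neq0 t : 1 + t != 0 -> 1 + t^* != 0.
Proof. by rewrite -{2}conjC1 -conjcD conjC_eq0. Qed.

Lemma unit_neq0 d : d * d^* = 1 -> d != 0.
Proof. by apply: contra_eq_neq => ->; rewrite mul0r eq_sym oner_eq0. Qed.

Lemma unit_conj d : d * d^* = 1 -> d^* = d^-1.
Proof.
by move=> dd; apply: (mulfI (unit_neq0 dd)); rewrite dd mulfV// unit_neq0.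
Qed.

Lemma addr_conj_neq0 d t : d * d^* = 1 -> 1 + d * t != 0 -> d + t^* != 0.
Proof.
move=> dd; apply: contra_neq => e.
by rewrite -dd -mulrDr -[t]conjCK -conjcD e conjC0 mulr0.
Qed.

(** The reflection at the intermediate vector [(d t, x)] cancels. In coordinates both sides add to
    [w] a multiple of [<x, w> x], and [vnorm x = 1 - |t|^2] leaves an identity between values of
    [kappa]. *)
Lemma twist_twist d e x t w : t * t^* + vnorm x = 1 ->
  1 + t != 0 -> d * d^* = 1 -> 1 + d * t != 0 -> 1 + e * d * t != 0 ->
  twist e x (d * t) (twist d x t w) = twist (e * d) x t w.
Proof.
move=> tx t0 dd dt0 edt0; apply/funext => m; rewrite [LHS]/twist dot_twist /twist.
have -> : vnorm x = 1 - t * t^* by rewrite -tx; ring.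
rewrite -addrA; congr (_ + _).
rewrite [RHS](_ : _ = kappa (e * d) t * (dot x w * x m)); last by rewrite mulrA.
set s := dot x w.
rewrite [LHS](_ : _ =
  (kappa d t + kappa e (d * t) * (1 + kappa d t * (1 - t * t^*))) * (s * x m)); last by ring.
congr (_ * _); rewrite /kappa conjcM mulrA.
rewrite (unit_conj dd).
field.
by rewrite edt0 conjc_1D_neq0// dt0 unit_neq0// addr_conj_neq0.
Qed.

(** With [k = kappa d t], the squared norm changes by [(k^* + k + |k|^2 |x|^2) |<x, w>|^2], and the
    bracket vanishes. *)
Lemma vnorm_twist d x t w : t * t^* + vnorm x = 1 ->
  1 + t != 0 -> d * d^* = 1 -> 1 + d * t != 0 -> vnorm (twist d x t w) = vnorm w.
Proof.
move=> tx t0 dd dt0.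
have xE : dot x x = 1 - t * t^* by rewrite -tx /vnorm; ring.
have kk : (kappa d t)^* + kappa d t + kappa d t * (kappa d t)^* * dot x x = 0.
  rewrite xE /kappa fmorph_div /= conjcM !conjcD conjcM rmorphN conjC1 conjCK.
  rewrite unit_conj//.
  field.
  by rewrite t0 addr_conj_neq0// conjc_1D_neq0// dt0 unit_neq0.
rewrite /vnorm dot_addr -[dot (twist _ _ _ _) w]dot_conj.
rewrite -[dot (twist _ _ _ _) x]dot_conj dot_twist dot_addr -/(vnorm x).
move: (kappa d t) kk => k kk.
rewrite !(conjcM, conjcD) conjC1 !dot_conj /vnorm.
rewrite [LHS](_ : _ = dot w w + (k^* + k + k * k^* * dot x x)
  * (dot w x * dot x w)); last by ring.
by rewrite kk mul0r addr0.
Qed.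

Lemma weyl_vnorm1 v : vnorm v = 1 ->
  weyl 1 0 v * (weyl 1 0 v)^* + vnorm (weyl1 v) = 1.
Proof. by rewrite weyl_parseval => ->; rewrite expr1n. Qed.

Lemma vnorm_fibre_map g v w : vnorm v = 1 -> vnorm (fibre_map g v w) = vnorm w.
Proof.
move=> v1; rewrite /vnorm dot_diag_act; apply: vnorm_twist.
- exact: weyl_vnorm1.
- exact: weyl10_neqN1.
- exact: W_mul_conj.
- exact: weyl10_twist_neqN1.
Qed.

(** This cocycle identity makes the maps on the two spheres an action: [diag_act h] passes through
    the second twist, after which the twists compose. *)
Lemma fibre_mapM g h v w : vnorm v = 1 ->
  fibre_map (g * h)%g v w = fibre_map g (schroedinger h v) (fibre_map h v w).
Proof.
move=> v1; rewrite /fibre_map weyl1_schroedinger weyl10_schroedinger.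
rewrite -diag_act_twist diag_actM; congr (diag_act _ (diag_act _ _)).
rewrite twist_twist -?WD //.
- exact: weyl_vnorm1.
- exact: weyl10_neqN1.
- exact: W_mul_conj.
- exact: weyl10_twist_neqN1.
- exact: (weyl10_twist_neqN1 (g * h)%g).
Qed.

Lemma fibre_map1 v w : fibre_map 1%g v w = w.
Proof.
apply/funext => m; rewrite /fibre_map -[1%g]/(heis_one R) /diag_act /twist /kappa.
by rewrite /= !(mulr0, subr0, omegaX0) subrr !mul0r addr0 mul1r.
Qed.

(** Scalars of modulus 1 leave every [<v, h v>] unchanged. *)
Lemma fibre_mapMz g z v w : fibre_map (g * Heis z 0 0)%g v w = fibre_map g v w.
Proof.
rewrite /fibre_map /diag_act -[(g * _)%g]/(heis_mul g (Heis z 0 0)) /heis_mul /=.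
by rewrite !addr0.
Qed.

Lemma W_fixed (k : 'I_3) t : W k * t = t -> k != 0 -> t = 0.
Proof.
move=> Wt k0; apply/eqP; apply: contraNT k0 => t0; apply/eqP/omegaX_eq1/val_inj.
by apply: (mulIf t0); rewrite Wt [RHS]mul1r.
Qed.

Lemma ord3_sqr (j : 'I_3) : j != 0 -> j * j = 1.
Proof. by elim/ord3E: j => // _; exact: val_inj. Qed.

Lemma vnorm_eq0 w : (forall m, w m = 0) -> vnorm w = 0.
Proof. by move=> w0; apply: big1 => m _; rewrite w0 mulr0. Qed.

Lemma fibre_map_fixed g v w : vnorm v = 1 -> schroedinger g v = v ->
  fibre_map g v w = w -> vnorm w != 0 -> g = 1%g.
Proof.
move=> v1 gv gw; apply: contraNeq => g1; apply/eqP/vnorm_eq0.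
have := weyl_vnorm1 v1; have := weyl10_schroedinger g v.
have := weyl1_schroedinger g v; rewrite gv; move: gw; rewrite /fibre_map /diag_act.
move: (weyl1 v) (weyl 1 0 v) => x t gw xE tE tx.
have Wx m : W (m * heis_j g - heis_i g) * x m = x m.
  exact: esym (congr1 (fun f : 'I_3 -> C => f m) xE).
have Ww m : W (m * heis_j g - heis_i g) *
    twist (W (heis_j g)) x t w m = w m.
  exact: (congr1 (fun f : 'I_3 -> C => f m) gw).
(* If [heis_j g] is 0, all three characters in [diag_act] equal [W (- heis_i g)]. This is
   nontrivial, since a scalar fixing the nonzero [v] is 1; so first [x], and then [w], vanishes. *)
have [j0|j0] := eqVneq (heis_j g) 0.
  have i0 : heis_i g != 0.
    apply: contraNneq g1 => i0;
    case: g i0 j0 gv {gw xE tE Wx Ww} => z i j /= -> -> gv.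
    have [k vk] : exists k, v k != 0.
      apply: contrapT => v0; have : (1 : C) != 0 by exact: oner_neq0.
      rewrite -v1 vnorm_eq0 ?eqxx// => k.
      by apply/eqP; apply: contrapT => /negP vk; apply: v0; exists k.
    apply/eqP/heis_eq => //; apply: (mulIf vk).
    have /(congr1 (@^~ k)) := gv.
    by rewrite /schroedinger /= subr0 mulr1 mul1r.
  move=> m; have := Wx m; have := Ww m; rewrite /twist j0 mulr0 sub0r => + Wxm.
  have Ni0 : - heis_i g != 0 by rewrite oppr_eq0.
  by rewrite (W_fixed Wxm Ni0) mulr0 addr0 => /W_fixed; apply.
(* Now the character on the first axis is nontrivial. As [heis_j g] squares to 1, only the index
   [heis_i g * heis_j g] has trivial character, and [x] and [w] vanish at the others. *)
have t0 := W_fixed (esym tE) j0.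
have w0 m : m != heis_i g * heis_j g -> w m = 0.
  move=> mij; have k0 : m * heis_j g - heis_i g != 0.
    apply: contra_neq mij => /eqP; rewrite subr_eq0 => /eqP <-.
    by rewrite -mulrA ord3_sqr// mulr1.
  have := Ww m; rewrite /twist (W_fixed (Wx m) k0) mulr0 addr0 => /W_fixed; exact.
move=> m; have [->{m}|/w0//] := eqVneq m (heis_i g * heis_j g).
set m := (_ * _ : 'I_3).
have mj : m * heis_j g = heis_i g by rewrite /m -mulrA ord3_sqr// mulr1.
(* On the remaining axis the fixed point equation kills the correction term of [twist]. There
   [t = 0] makes [kappa] equal to [W (heis_j g) - 1], which is nonzero, and [x m] has modulus 1, so
   [w m = 0]. *)
have : kappa (W (heis_j g)) t * dot x w * x m = 0.
  have := Ww m; rewrite /twist mj subrr omegaX0 mul1r.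
  by rewrite -[X in _ = X -> _]addr0 => /addrI.
rewrite /kappa t0 conjC0 mulr0 addr0 mulr1 divr1 -mulrA => /eqP; rewrite mulf_eq0.
move=> /orP[|].
  rewrite subr_eq0 => /eqP Wj.
  have /omegaX_eq1 j00 : omegaX R (heis_j g) = 1%g by exact: val_inj.
  by rewrite j00 eqxx in j0.
have -> : dot x w = (x m)^* * w m.
  by rewrite /dot (bigD1 m)//= big1 ?addr0// => k /w0 ->; rewrite mulr0.
have xm0 k : k != m -> x k = 0.
  move=> km; apply: W_fixed (Wx k) _; apply: contra_neq km => /eqP.
  by rewrite subr_eq0 => /eqP; rewrite /m => <-; rewrite -mulrA ord3_sqr// mulr1.
have : (x m)^* * x m = 1.
  rewrite -tx t0 mul0r add0r /vnorm /dot (bigD1 m)//= big1 ?addr0//.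
  by move=> k /xm0 ->; rewrite mulr0.
by rewrite mulrAC => -> /eqP; rewrite mul1r.
Qed.

End WeylCoefficients.

(** * Closure properties of [Ck] maps *)

Section CkCalculus.
Variables (R : realType) (V : normedModType R).
Implicit Types (W : normedModType R) (U : set V) (k : nat).

Lemma Ck_continuous W k U (f : V -> W) x : Ck k U f -> U x -> {for x, continuous f}.
Proof. by case: k => [|k] [fc _]; exact: fc. Qed.

Lemma Ck_eq W U k (f g : V -> W) : open U ->
  (forall x, U x -> f x = g x) -> Ck k U f -> Ck k U g.
Proof.
move=> oU; elim: k f g => [|k IH] f g fg [fc fD].
- split=> // x Ux; rewrite /prop_for /continuous_at -(fg _ Ux).
  apply: cvg_trans (fc _ Ux); apply: near_eq_cvg.
  by apply: filterS (open_nbhs_nbhs (conj oU Ux)); exact: fg.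
- split=> [x Ux|v].
    rewrite /prop_for /continuous_at -(fg _ Ux).
    apply: cvg_trans (fc _ Ux); apply: near_eq_cvg.
    by apply: filterS (open_nbhs_nbhs (conj oU Ux)); exact: fg.
  have [fv fDv] := fD v.
  have fgx x : U x -> {near x, f =1 g}.
    by move=> Ux; apply: filterS (open_nbhs_nbhs (conj oU Ux)); exact: fg.
  split=> [x Ux|]; first exact: near_eq_derivable (fgx x Ux) (fv x Ux).
  by apply: IH fDv => x Ux; apply: near_eq_derive; exact: fgx.
Qed.

Lemma CkS W U k (f : V -> W) : Ck k.+1 U f -> Ck k U f.
Proof.
elim: k f => [|k IH] f [fc fD]; first by [].
by split=> // v; have [fv fDv] := fD v; split=> //; exact: IH.
Qed.

(** Reduces each closure property to a formula for the directional derivative valid on [U]. *)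
Lemma Ck_derive W U k (f : V -> W) : open U ->
  (forall x, U x -> {for x, continuous f}) ->
  (forall v, exists2 f' : V -> W,
    (forall x, U x -> is_derive x v f (f' x)) & Ck k U f') ->
  Ck k.+1 U f.
Proof.
move=> oU fc fD; split=> // v; have [f' ff' Cf'] := fD v.
split=> [x /ff'[]//|]; apply: Ck_eq Cf' => // x /ff'[].
by move=> _ ->.
Qed.

Lemma Ck_cst W U k (a : W) : open U -> Ck k U (fun=> a).
Proof.
move=> oU; elim: k a => [|k IH] a; first by split=> // x _; exact: cvg_cst.
apply: Ck_derive => // [x _|v]; first exact: cvg_cst.
exists (fun=> 0) => // x _; exact: is_derive_cst.
Qed.

Lemma CkD W U k (f g : V -> W) : open U ->
  Ck k U f -> Ck k U g -> Ck k U (fun x => f x + g x).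
Proof.
move=> oU; elim: k f g => [|k IH] f g Cf Cg.
  by split=> // x Ux; apply: continuousD;
    [exact: Ck_continuous Cf Ux|exact: Ck_continuous Cg Ux].
apply: Ck_derive => // [x Ux|v].
  by apply: continuousD;
    [exact: Ck_continuous Cf Ux|exact: Ck_continuous Cg Ux].
case: Cf Cg => [_ /(_ v) [fv fDv]] [_ /(_ v) [gv gDv]].
exists (fun x => 'D_v f x + 'D_v g x); last exact: IH.
by move=> x Ux; apply: is_deriveD; apply/derivableP; [exact: fv|exact: gv].
Qed.

Lemma CkM U k (f g : V -> R) : open U ->
  Ck k U f -> Ck k U g -> Ck k U (fun x => f x * g x).
Proof.
move=> oU; elim: k f g => [|k IH] f g Cf Cg.
  by split=> // x Ux; apply: continuousM;
    [exact: Ck_continuous Cf Ux|exact: Ck_continuous Cg Ux].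
apply: Ck_derive => // [x Ux|v].
  by apply: continuousM;
    [exact: Ck_continuous Cf Ux|exact: Ck_continuous Cg Ux].
(* The Leibniz formula also contains [f] and [g] themselves, needed here at order [k]. *)
have [Cf' Cg'] := (CkS Cf, CkS Cg).
case: Cf Cg => [_ /(_ v) [fv fDv]] [_ /(_ v) [gv gDv]].
exists (fun x => f x * 'D_v g x + g x * 'D_v f x).
  by move=> x Ux; apply: is_deriveM; apply/derivableP; [exact: fv|exact: gv].
by apply: CkD => //; exact: IH.
Qed.

Lemma CkV U k (f : V -> R) : open U -> (forall x, U x -> f x != 0) ->
  Ck k U f -> Ck k U (fun x => (f x)^-1).
Proof.
move=> oU f0; elim: k => [|k IH] Cf.
  by split=> // x Ux; apply: continuousV (f0 _ Ux) _; exact: Ck_continuous Cf Ux.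
apply: Ck_derive => // [x Ux|v].
  by apply: continuousV (f0 _ Ux) _; exact: Ck_continuous Cf Ux.
have CfV := IH (CkS Cf); case: Cf => [_ /(_ v) [fv fDv]].
exists (fun x => (- 1 * ((f x)^-1 * (f x)^-1)) * 'D_v f x).
  move=> x Ux; have f0x := f0 x Ux; split; first exact: derivableV (fv x Ux).
  by rewrite deriveV// ?mulN1r ?expr2 ?invfM//; exact: fv.
by do ![apply: CkM => //]; exact: Ck_cst.
Qed.

Lemma Ck_id U k : open U -> Ck k U (id : V -> V).
Proof.
move=> oU; case: k => [|k]; first by split=> // x _; exact: cvg_id.
apply: Ck_derive => // [x _|v]; first exact: cvg_id.
exists (fun=> v); last exact: Ck_cst.
by move=> x _; exact: is_derive_id.
Qed.

(** A continuous linear map commutes with difference quotients and their limits. Scaling a vector,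
    pairing, projections and coordinates are all instances. *)
Lemma Ck_comp_linear (W W' : normedModType R) U k (L : W -> W') (f : V -> W) :
  open U -> (forall a u w, L (a *: u + w) = a *: L u + L w) -> continuous L ->
  Ck k U f -> Ck k U (fun x => L (f x)).
Proof.
move=> oU Llin Lc; have L0 : L 0 = 0.
  by apply: (addrI (L 0)); rewrite addr0 -{1}[L 0]scale1r -Llin scale1r addr0.
have LZ a u : L (a *: u) = a *: L u by rewrite -[a *: u]addr0 Llin L0 addr0.
have LB u w : L (u - w) = L u - L w.
  by rewrite addrC -scaleN1r Llin scaleN1r addrC.
elim: k f => [|k IH] f Cf.
  by split=> // x Ux; apply: continuous_comp;
    [exact: Ck_continuous Cf Ux|exact: Lc].
apply: Ck_derive => // [x Ux|v].
  by apply: continuous_comp; [exact: Ck_continuous Cf Ux|exact: Lc].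
case: Cf => [_ /(_ v) [fv fDv]].
exists (fun x => L ('D_v f x)); last exact: IH.
move=> x Ux; have fvx := fv x Ux.
have e : (fun h : R =>
    h^-1 *: (((fun x => L (f x)) \o shift x) (h *: v) - L (f x))) =
    (fun h => L (h^-1 *: ((f \o shift x) (h *: v) - f x))).
  by apply/funext => h /=; rewrite LZ LB.
have lim : h^-1 *: (((fun x => L (f x)) \o shift x) (h *: v) - L (f x)) @[h --> 0^']
    --> L ('D_v f x).
  by rewrite e; apply: (cvg_comp _ _ fvx); exact: Lc.
split; first by apply/cvg_ex; exists (L ('D_v f x)).
exact: cvg_lim lim.
Qed.

Lemma Ck_scale W U k (f : V -> R) (a : W) : open U ->
  Ck k U f -> Ck k U (fun x => f x *: a).
Proof.
move=> oU; apply: (Ck_comp_linear (L := fun r : R => r *: a)) => // [b u w|r].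
  by rewrite scalerDl scalerA.
by apply: cvgZr_tmp; exact: cvg_id.
Qed.

Lemma Ck_pair (W W' : normedModType R) U k (f : V -> W) (g : V -> W') : open U ->
  Ck k U f -> Ck k U g -> Ck k U (fun x => (f x, g x)).
Proof.
move=> oU Cf Cg.
rewrite (_ : (fun x => _) = fun x => (f x, 0) + (0, g x)); last first.
  by apply/funext => x; congr pair; rewrite /= ?addr0 ?add0r.
apply: CkD => //.
  apply: (Ck_comp_linear (L := fun u => (u, 0))) => // [a u w|u].
    by congr pair; rewrite /= scaler0 addr0.
  by apply: cvg_pair; [exact: cvg_id|exact: cvg_cst].
apply: (Ck_comp_linear (L := fun u => (0, u))) => // [a u w|u].
  by congr pair; rewrite /= scaler0 addr0.
by apply: cvg_pair; [exact: cvg_cst|exact: cvg_id].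
Qed.

Lemma Ck_sum W U k n (f : 'I_n -> V -> W) : open U ->
  (forall i, Ck k U (f i)) -> Ck k U (fun x => \sum_i f i x).
Proof.
move=> oU; elim: n f => [|n IH] f Cf.
  by apply: (Ck_eq (f := fun=> 0)) => // [x _|]; [rewrite big_ord0|exact: Ck_cst].
apply: (Ck_eq (f := fun x => f ord0 x + \sum_i f (lift ord0 i) x)) => // [x _|].
  by rewrite big_ord_recl.
by apply: CkD => //; apply: IH.
Qed.

End CkCalculus.

(** * Complex-valued functions, smooth in the real sense *)

Section ComplexSmooth.
Variables (R : realType) (V : normedModType R) (U : set V).
Hypothesis oU : open U.
Local Notation C := R[i].

Lemma normsq_eq0 (z : C) :
  (complex.Re z * complex.Re z + complex.Im z * complex.Im z == 0) = (z == 0).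
Proof. by rewrite eq_complex/= -!expr2 paddr_eq0 ?sqr_ge0// !sqrf_eq0. Qed.

Definition csmooth (f : V -> C) :=
  Cinfty U (fun x => complex.Re (f x)) /\ Cinfty U (fun x => complex.Im (f x)).

Lemma csmooth_ext (f g : V -> C) : f =1 g -> csmooth f -> csmooth g.
Proof. by move=> /funext ->. Qed.

Lemma csmooth_cst a : csmooth (fun=> a).
Proof. by split=> k; exact: Ck_cst. Qed.

Lemma csmoothD f g : csmooth f -> csmooth g -> csmooth (fun x => f x + g x).
Proof.
move=> [fr fi] [gr gi]; split=> k.
  rewrite [X in Ck _ _ X](_ : _ = fun x => complex.Re (f x) + complex.Re (g x)).
    exact: CkD.
  by apply/funext => x; case: (f x) (g x) => ? ? [].
rewrite [X in Ck _ _ X](_ : _ = fun x => complex.Im (f x) + complex.Im (g x)).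
  exact: CkD.
by apply/funext => x; case: (f x) (g x) => ? ? [].
Qed.

Lemma CkN k (f : V -> R) : Ck k U f -> Ck k U (fun x => - f x).
Proof.
move=> Cf; rewrite (_ : (fun x => - f x) = fun x => -1 * f x).
  by apply: CkM => //; exact: Ck_cst.
by apply/funext => x; rewrite mulN1r.
Qed.

Lemma csmoothM f g : csmooth f -> csmooth g -> csmooth (fun x => f x * g x).
Proof.
move=> [fr fi] [gr gi]; split=> k.
  rewrite [X in Ck _ _ X](_ : _ = fun x => complex.Re (f x) * complex.Re (g x)
      + - (complex.Im (f x) * complex.Im (g x))).
    by apply: CkD => //; [exact: CkM|apply: CkN; exact: CkM].
  by apply/funext => x; case: (f x) (g x) => ? ? [].
rewrite [X in Ck _ _ X](_ : _ = fun x => complex.Re (f x) * complex.Im (g x)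
    + complex.Im (f x) * complex.Re (g x)).
  by apply: CkD => //; exact: CkM.
by apply/funext => x; case: (f x) (g x) => ? ? [].
Qed.

Lemma csmooth_conj f : csmooth f -> csmooth (fun x => (f x)^*).
Proof.
move=> [fr fi]; split=> k.
  rewrite [X in Ck _ _ X](_ : _ = fun x => complex.Re (f x)) //.
  by apply/funext => x; case: (f x).
rewrite [X in Ck _ _ X](_ : _ = fun x => - complex.Im (f x)); first exact: CkN.
by apply/funext => x; case: (f x).
Qed.

Lemma csmoothV f : (forall x, U x -> f x != 0) ->
  csmooth f -> csmooth (fun x => (f x)^-1).
Proof.
move=> f0 [fr fi].
(* The inverse is the conjugate divided by this squared modulus. *)
pose n2 x :=
  complex.Re (f x) * complex.Re (f x) + complex.Im (f x) * complex.Im (f x).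
have Cn2V k : Ck k U (fun x => (n2 x)^-1).
  apply: CkV => // [x /f0|]; last by apply: CkD => //; exact: CkM.
  by rewrite /n2 normsq_eq0.
split=> k.
  rewrite [X in Ck _ _ X](_ : _ = fun x => complex.Re (f x) * (n2 x)^-1).
    exact: CkM.
  by apply/funext => x; rewrite /n2; case: (f x) => ? ?; rewrite /= !expr2.
rewrite [X in Ck _ _ X](_ : _ = fun x => - (complex.Im (f x) * (n2 x)^-1)).
  by apply: CkN; exact: CkM.
by apply/funext => x; rewrite /n2; case: (f x) => ? ?; rewrite /= !expr2.
Qed.

Lemma csmooth_sum n (f : 'I_n -> V -> C) : (forall i, csmooth (f i)) ->
  csmooth (fun x => \sum_i f i x).
Proof.
elim: n f => [|n IH] f Cf.
  by apply: csmooth_ext (csmooth_cst 0) => x; rewrite big_ord0.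
apply: csmooth_ext (csmoothD (Cf ord0) (IH (fun i => f (lift ord0 i)) _)) => //.
by move=> x; rewrite big_ord_recl.
Qed.

End ComplexSmooth.

(** * The action on pairs of points of the sphere in [C^3] *)

Section Sphere.
Variable R : realType.
Local Notation C := R[i].

Definition complexify (x : 'rV[R]_(3 + 3)) : 'I_3 -> C :=
  fun k => Complex (x ord0 (lshift 3 k)) (x ord0 (rshift 3 k)).

Definition realify (v : 'I_3 -> C) : 'rV[R]_(3 + 3) :=
  row_mx (\row_k complex.Re (v k)) (\row_k complex.Im (v k)).

Lemma complexifyK x : realify (complexify x) = x.
Proof.
by rewrite -[RHS]hsubmxK; congr row_mx; apply/rowP => k; rewrite !mxE.
Qed.

Lemma realifyK v : complexify (realify v) = v.
Proof.
apply/funext => k; rewrite /complexify /realify row_mxEl row_mxEr !mxE.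
by case: (v k).
Qed.

Lemma vnorm_complexify x :
  vnorm (complexify x) = (\sum_(i < 3 + 3) x ord0 i ^+ 2)%:C%C.
Proof.
rewrite big_split_ord /= -big_split rmorph_sum; apply: eq_bigr => k _ /=.
by rewrite mulrC -normCK -add_Re2_Im2.
Qed.

Lemma sphere_vnorm (x : sphere R 5) : vnorm (complexify (val x)) = 1.
Proof. by rewrite vnorm_complexify; have /eqP -> := valP x. Qed.

Lemma realify_sphere v : vnorm v = 1 ->
  \sum_(i < 6) (realify v : 'rV[R]_6) ord0 i ^+ 2 == 1.
Proof. by rewrite -{1}[v]realifyK vnorm_complexify => /complexI ->. Qed.

Definition sphere_of v (v1 : vnorm v = 1) : sphere R 5 :=
  exist (fun x : 'rV[R]_6 => \sum_i x ord0 i ^+ 2 == 1) _ (realify_sphere v1).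

Lemma schroedinger_sphere (g : heis R) (x : sphere R 5) :
  vnorm (schroedinger g (complexify (val x))) = 1.
Proof. by rewrite vnorm_schroedinger sphere_vnorm. Qed.

Lemma fibre_map_sphere (g : heis R) (x y : sphere R 5) :
  vnorm (fibre_map g (complexify (val x)) (complexify (val y))) = 1.
Proof. by rewrite vnorm_fibre_map sphere_vnorm. Qed.

Definition heis_act (g : heis R) (p : S5xS5 R) : S5xS5 R :=
  (sphere_of (schroedinger_sphere g p.1), sphere_of (fibre_map_sphere g p.1 p.2)).

Lemma heis_act1 p : heis_act 1%g p = p.
Proof.
case: p => x y; congr pair; apply: val_inj => /=.
  by rewrite schroedinger1 complexifyK.
by rewrite fibre_map1 complexifyK.
Qed.

Lemma heis_actM g h p : heis_act (g * h)%g p = heis_act g (heis_act h p).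
Proof.
case: p => x y; congr pair; apply: val_inj => /=; rewrite !realifyK.
  by rewrite schroedingerM.
by rewrite fibre_mapM// sphere_vnorm.
Qed.

Lemma heis_act_free g p : heis_act g p = p -> g = 1%g.
Proof.
case: p => x y [gx gy].
move: (congr1 (complexify \o val) gx) (congr1 (complexify \o val) gy) => /=.
rewrite !realifyK => {}gx {}gy; apply: fibre_map_fixed gx gy _.
  exact: sphere_vnorm.
by rewrite sphere_vnorm oner_eq0.
Qed.

End Sphere.

(** * Smoothness of the action *)

Section SmoothAction.
Variable R : realType.
Local Notation C := R[i].
Local Notation W k := (omegaX R k : C).
Local Notation V := ((R * R) * ('rV[R]_6 * 'rV[R]_6))%type.

Lemma Ck_realify (T : normedModType R) (S : set T) k (f : T -> 'I_3 -> C) :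
  open S -> (forall m, csmooth S (fun q => f q m)) ->
  Ck k S (fun q => realify (f q) : 'rV[R]_6).
Proof.
move=> oS Cf.
apply: (Ck_eq (f := fun q =>
  (\sum_m complex.Re (f q m) *: (delta_mx ord0 (lshift 3 m) : 'rV[R]_(3 + 3))) +
  \sum_m complex.Im (f q m) *: (delta_mx ord0 (rshift 3 m) : 'rV[R]_(3 + 3)))) => //.
  move=> q _; rewrite /realify [RHS]row_sum_delta big_split_ord /=.
  by congr (_ + _); apply: eq_bigr => m _; rewrite ?(row_mxEl, row_mxEr) mxE.
by apply: CkD => //; apply: Ck_sum => // m; apply: Ck_scale => //; apply Cf.
Qed.

(** Complex coordinates of an arbitrary ambient point, on or off the circle and the spheres. *)
Definition pt_z (q : V) : C := Complex q.1.1 q.1.2.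
Definition pt_x (q : V) : 'I_3 -> C := complexify q.2.1.
Definition pt_y (q : V) : 'I_3 -> C := complexify q.2.2.

Lemma Ck_fst (A B T : normedModType R) (S : set T) k (f : T -> A * B) : open S ->
  Ck k S f -> Ck k S (fun q => (f q).1).
Proof.
by move=> oS; apply: (Ck_comp_linear (L := fst)) => // x; exact: cvg_fst.
Qed.

Lemma Ck_snd (A B T : normedModType R) (S : set T) k (f : T -> A * B) : open S ->
  Ck k S f -> Ck k S (fun q => (f q).2).
Proof.
by move=> oS; apply: (Ck_comp_linear (L := snd)) => // x; exact: cvg_snd.
Qed.

Lemma Ck_coord (T : normedModType R) (S : set T) k n (f : T -> 'rV[R]_n) i :
  open S -> Ck k S f -> Ck k S (fun q => f q ord0 i).
Proof.
move=> oS; apply: (Ck_comp_linear (L := fun x : 'rV[R]_n => x ord0 i)) => //.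
  by move=> a u w; rewrite !mxE.
exact: coord_continuous.
Qed.

Lemma csmooth_pt_z (U : set V) : open U -> csmooth U pt_z.
Proof.
move=> oU; split=> k /=.
  by do 2!apply: Ck_fst => //; exact: Ck_id.
by apply: Ck_snd => //; apply: Ck_fst => //; exact: Ck_id.
Qed.

Lemma csmooth_pt_x (U : set V) m : open U -> csmooth U (fun q => pt_x q m).
Proof.
by move=> oU; split=> k /=; apply: Ck_coord => //;
  apply: Ck_fst => //; apply: Ck_snd => //; exact: Ck_id.
Qed.

Lemma csmooth_pt_y (U : set V) m : open U -> csmooth U (fun q => pt_y q m).
Proof.
by move=> oU; split=> k /=; apply: Ck_coord => //;
  do 2!apply: Ck_snd => //; exact: Ck_id.
Qed.

Lemma csmooth_weyl (U : set V) m n : open U -> csmooth U (fun q => weyl m n (pt_x q)).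
Proof.
move=> oU; apply: csmooth_sum => // k; apply: csmoothM => //.
  apply: csmoothM => //; last exact: csmooth_cst.
  by apply: csmooth_conj => //; exact: csmooth_pt_x.
exact: csmooth_pt_x.
Qed.

Lemma csmooth_neq0_open (f : V -> C) : csmooth setT f -> open [set q | f q != 0].
Proof.
move=> [fr fi].
pose n2 q :=
  complex.Re (f q) * complex.Re (f q) + complex.Im (f q) * complex.Im (f q).
rewrite (_ : [set q | _] = n2 @^-1` [set r | r != 0]).
  apply: open_comp; last exact: open_neq.
  move=> q _; apply: (Ck_continuous (k := 0) (U := setT)) => //.
  by apply: CkD; [exact: openT| |]; apply: CkM => //; exact: openT.
by apply/funext => q; rewrite /preimage /= /n2 normsq_eq0.
Qed.

(** The locus where the denominator of [kappa] is nonzero. It contains the whole product of the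
    circle and the spheres, so one extension serves at every point. *)
Definition chart_dom (g : heis R) : set V :=
  [set q | (1 + (weyl 1 0 (pt_x q))^*) *
    (1 + W (heis_j g) * weyl 1 0 (pt_x q)) != 0].

Lemma chart_dom_open g : open (chart_dom g).
Proof.
apply: csmooth_neq0_open; have oT : open [set: V] by exact: openT.
have Cw := csmooth_weyl 1 0 oT; have C1 := csmooth_cst oT.
apply: csmoothM => //; apply: csmoothD => //.
  exact: csmooth_conj.
exact: csmoothM.
Qed.

Lemma csmooth_fibre_map g m :
  csmooth (chart_dom g) (fun q => fibre_map g (pt_x q) (pt_y q) m).
Proof.
have oU : open (chart_dom g) by exact: chart_dom_open.
have C1 c : csmooth (chart_dom g) (fun=> c) by exact: csmooth_cst.
have Cx n := csmooth_weyl n 1 oU; have Ct := csmooth_weyl 1 0 oU.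
apply: csmoothM => //; apply: csmoothD => //; first exact: csmooth_pt_y.
apply: csmoothM => //; last exact: Cx.
apply: csmoothM => //.
  apply: csmoothM => //; apply: csmoothV => //.
  apply: csmoothM => //; apply: csmoothD => //; first exact: csmooth_conj.
  exact: csmoothM.
apply: csmooth_sum => // k; apply: csmoothM => //; last exact: csmooth_pt_y.
by apply: csmooth_conj => //; exact: Cx.
Qed.

(** Extends the action of the coset of [g] to ambient points; the circle variable enters only the
    first component, by [fibre_mapMz]. *)
Definition chart_map (g : heis R) (q : V) : 'rV[R]_6 * 'rV[R]_6 :=
  (realify (fun k =>
     (heis_z g : C) * pt_z q * W (heis_i g * k) * pt_x q (k - heis_j g)),
   realify (fibre_map g (pt_x q) (pt_y q))).

Lemma chart_map_smooth g : Cinfty (chart_dom g) (chart_map g).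
Proof.
move=> k; have oU : open (chart_dom g) by exact: chart_dom_open.
have C1 c : csmooth (chart_dom g) (fun=> c) by exact: csmooth_cst.
apply: Ck_pair => //; apply: Ck_realify => // m; last exact: csmooth_fibre_map.
apply: csmoothM => //; last exact: csmooth_pt_x.
apply: csmoothM => //; apply: csmoothM => //; exact: csmooth_pt_z.
Qed.

Lemma chart_mapE g (p : circle R * S5xS5 R) :
  chart_map g (prod_incl (@circle_incl R) (@S5xS5_incl R) p) =
  S5xS5_incl (heis_act (g * Heis p.1 0 0)%g p.2).
Proof.
case: p => z [x y]; congr pair; congr realify; apply/funext => k /=; last first.
  by rewrite fibre_mapMz.
rewrite schroedingerM /schroedinger /= subr0 mulr1 /pt_z /pt_x /=.
rewrite (_ : Complex _ _ = z :> C); first by ring.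
by case: (z : C).
Qed.

Lemma heis_act_smooth g :
  smooth_map (prod_incl (@circle_incl R) (@S5xS5_incl R)) (@S5xS5_incl R)
    (fun p : circle R * S5xS5 R => heis_act (g * Heis p.1 0 0)%g p.2).
Proof.
move=> [z [x y]]; exists (chart_dom g), (chart_map g); split.
- exact: chart_dom_open.
- rewrite /chart_dom /= mulf_neq0//.
    apply: conjc_1D_neq0; apply: weyl10_neqN1; exact: sphere_vnorm.
  by apply: weyl10_twist_neqN1; exact: sphere_vnorm.
- exact: chart_map_smooth.
- by move=> p _; exact: chart_mapE.
Qed.

End SmoothAction.

Theorem theoremA (R : realType) :
  exists act : Gamma R -> S5xS5 R -> S5xS5 R,
    [/\ is_left_action act, is_free_action act & is_smooth_action act].
Proof.
exists (fun g => heis_act (heis_of g)); split.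
- by split=> [p|g h p]; rewrite ?heis_of1 ?heis_act1// heis_ofM heis_actM.
- by move=> g p /heis_act_free /heis_of_inj.
- move=> g; rewrite /Gamma_coset.
  (* On the coset of [g], the normal form is that of [g] times the central element [Heis z 0 0]. *)
  under [X in smooth_map _ _ X]funext do rewrite heis_ofM heis_of_gen.
  exact: heis_act_smooth.
Qed.
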